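(* Let $T$ be a tree with diameter at least $3$, let $n(T)$ be its order and $l(T)$ the number of its leaves (vertices of degree one). Then $\mu(S(T)) = n(T) + l(T)$.
   Context: All graphs are finite. The shadow graph $S(G)$ of a graph $G$ is obtained from $G$ by adding, for each vertex $v$ of $G$, a new vertex $v'$ (the shadow vertex of $v$), and joining $v'$ to all neighbours of $v$ in $G$ (shadow vertices are pairwise non-adjacent). For a vertex set $X$ of a graph $H$, two vertices $u,v$ are $X$-visible if there is a shortest $u,v$-path $P$ in $H$ with $V(P)\cap X \subseteq \{u,v\}$. The set $X$ is a mutual-visibility set if every two vertices of $X$ are $X$-visible; $\mu(H)$ is the maximum cardinality of a mutual-visibility set of $H$. *)

(* Defs.v *)
From mathcomp Require Import all_boot.

Set Implicit Arguments.
Unset Strict Implicit.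
Unset Printing Implicit Defensive.

(* A graph on a finite vertex type V is given by its adjacency relation. *)
Section Graphs.
Variables (V : finType) (e : rel V).

Definition simple_graph : Prop := symmetric e /\ irreflexive e.

(* As in path.v, the vertices of the path are u :: p, so its length (number of
   edges) is size p. *)
Definition is_path (u v : V) (p : seq V) : bool :=
  [&& path e u p, uniq (u :: p) & last u p == v].

(* Paths have length < #|V|; dist u v = #|V| when no u,v-path exists. *)
Definition dist (u v : V) : nat :=
  \big[minn/#|V|]_(n < #|V| | [exists p : n.-tuple V, is_path u v p]) n.

Definition diameter : nat := \max_(u : V) \max_(v : V) dist u v.

Definition connected_graph : Prop :=
  0 < #|V| /\ forall u v : V, exists p : seq V, is_path u v p.

(* The bound on size excludes the degenerate closed walk x, y, x along a
   single edge, which ucycle accepts. *)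
Definition acyclic_graph : Prop :=
  forall c : seq V, 2 < size c -> ~ ucycle e c.

Definition is_tree : Prop :=
  [/\ simple_graph, connected_graph & acyclic_graph].

Definition degree (v : V) : nat := #|[set w | e v w]|.

Definition leaves : {set V} := [set v | degree v == 1].

Definition visible (X : {set V}) (u v : V) : bool :=
  [exists p : (dist u v).-tuple V,
     is_path u v p && ([set w in u :: p] :&: X \subset [set u; v])].

Definition mutual_visibility (X : {set V}) : bool :=
  [forall u in X, forall v in X, visible X u v].

Definition mu : nat := \max_(X : {set V} | mutual_visibility X) #|X|.

(* inl v is the original vertex v, inr v its shadow v'. *)
Definition shadow : rel (V + V) := fun x y =>
  match x, y with
  | inl u, inl v => e u v
  | inl u, inr v => e u v
  | inr u, inl v => e u v
  | inr _, inr _ => false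
  end.

End Graphs.

(* Main.v *)
Require Import Defs.
From mathcomp Require Import all_boot.

Set Implicit Arguments.
Unset Strict Implicit.
Unset Printing Implicit Defensive.

(** Lower bound: all shadow vertices together with all leaves form a
    mutual-visibility set, because the interior of a path of [T] avoids the
    leaves; the only delicate pairs are the shadows of adjacent vertices, which
    are at distance 3 and are joined through a non-leaf neighbour.

    Upper bound: let [X] be a mutual-visibility set, and let [v] be a non-leaf
    with both copies in [X]. Every walk between two branches of [T - v] runs
    through a copy of [v], so [X] meets at most one branch; hence some
    neighbour [z] of [v], as well as all other neighbours of [z], has no copy in
    [X]. The map [v |-> z] is injective, so the non-leaves counted twice in [X]
    are compensated by vertices not counted at all. *)

(** * Shortest paths and visibility in a finite graph *)

Lemma bigmin_leq (I : eqType) (r : seq I) (P : pred I) (F : I -> nat) m i :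
  i \in r -> P i -> \big[minn/m]_(j <- r | P j) F j <= F i.
Proof.
elim: r => // j r IHr; rewrite inE big_cons => /orP[/eqP<- -> | ri Pi].
  exact: geq_minl.
by case: ifP => _; [rewrite geq_min IHr ?orbT | apply: IHr].
Qed.

Section Graph.
Variables (V : finType) (e : rel V).

Lemma is_path_size u v p : is_path e u v p -> size p < #|V|.
Proof. by case/and3P=> _ /card_uniqP /= <- _; apply: max_card. Qed.

Lemma dist_leq u v p : is_path e u v p -> dist e u v <= size p.
Proof.
move=> up; have lt_p := is_path_size up.
apply: (@bigmin_leq _ _ _ (fun i : 'I__ => i : nat) _ (Ordinal lt_p)).
  exact: mem_index_enum.
by apply/existsP; exists (in_tuple p).
Qed.

Lemma walk_is_path u p :
  path e u p -> exists2 q, is_path e u (last u p) q &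
    size q <= size p /\ {subset q <= p}.
Proof.
case/shortenP=> q ep uq sub_q; exists q; first exact/and3P.
by split=> //; apply: uniq_leq_size => //; case/andP: uq.
Qed.

(** Minimality ranges over all walks, not only simple paths: the projection of a path of the shadow
    graph may repeat vertices and still has to be compared with [p]. *)
Definition geodesic u v p :=
  is_path e u v p /\ forall q, path e u q -> last u q = v -> size p <= size q.

Lemma geodesic_dist u v p : geodesic u v p -> dist e u v = size p.
Proof.
case=> up min_p; apply/eqP; rewrite eqn_leq dist_leq //=.
apply: (big_ind (fun n => size p <= n)).
- exact/ltnW/(is_path_size up).
- by move=> m n; rewrite leq_min => -> ->.
move=> n /existsP[q /and3P[eq _ /eqP lq]].
by rewrite -[X in _ <= X](size_tuple q) min_p.
Qed.

Lemma geodesic_visible (X : {set V}) u v p :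
    geodesic u v p ->
    (forall w, w \in p -> w \in X -> w = v) ->
  visible e X u v.
Proof.
move=> gp avoid; have sz : size p == dist e u v by rewrite (geodesic_dist gp).
apply/existsP; exists (Tuple sz); case: gp => -> _ /=.
apply/subsetP=> w; rewrite !inE => /andP[/orP[->//|wp] wX].
by rewrite (avoid w) // eqxx orbT.
Qed.

Lemma geodesic_exists u v :
  (exists p, is_path e u v p) -> exists p, geodesic u v p.
Proof.
move=> [p0 p0P].
pose Q n := [exists p : n.-tuple V, is_path e u v p].
have exQ : exists n, Q n.
  by exists (size p0); apply/existsP; exists (in_tuple p0).
case: (ex_minnP exQ) => n /existsP[p pP] min_n; exists p; split=> // q eq lq.
have [q' q'P [le_q' _]] := walk_is_path eq; rewrite lq in q'P.
rewrite size_tuple (leq_trans _ le_q') // min_n //.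
by apply/existsP; exists (in_tuple q').
Qed.

(** * Leaves and separation in acyclic graphs *)

Lemma leaf_neighbor_unique v x y :
  v \in leaves e -> e v x -> e v y -> x = y.
Proof.
rewrite inE => /cards1P[z defN] vx vy.
have: x \in [set w | e v w] by rewrite inE.
have: y \in [set w | e v w] by rewrite inE.
by rewrite defN !inE => /eqP-> /eqP->.
Qed.

Hypotheses (eC : symmetric e) (eI : irreflexive e).

(** An interior vertex has a predecessor and a successor on the path; these differ by [uniq], while
    a leaf has a single neighbour. *)
Lemma interior_nonleaf u p v q :
  path e u (rcons p v) -> uniq (u :: rcons p v) -> q \in p -> q \notin leaves e.
Proof.
move=> ep up /splitPr qp; case: qp ep up => p1 p2.
rewrite rcons_cat rcons_cons; case: (rcons p2 v) (size_rcons p2 v) => // y r _.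
rewrite cat_path -cat_cons cat_uniq => /and4P[_ xq qy _] /and3P[_ disj _].
apply/negP=> lf; rewrite eC in xq; case/hasP: disj; exists y.
  by rewrite !inE eqxx orbT.
by rewrite -(leaf_neighbor_unique lf xq qy); apply: mem_last.
Qed.

(** A walk avoiding [u] shortens to a simple path, which [u] would close to a cycle; [z1 != z2]
    makes that cycle long enough. *)
Lemma acyclic_separates u z1 z2 p :
    acyclic_graph e -> e u z1 -> e u z2 -> z1 != z2 ->
    path e z1 p -> last z1 p = z2 -> u \in z1 :: p.
Proof.
move=> acy uz1 uz2 z12 ep lp; apply: contraT => uNp.
have [q /and3P[eq uq /eqP lq] [_ sub_q]] := walk_is_path ep.
rewrite lp in lq.
case: (acy (u :: z1 :: q)).
  by case: q lq {eq uq sub_q} => //= z1z2; rewrite z1z2 eqxx in z12.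
apply/andP; split; first by rewrite /= uz1 rcons_path eq lq eC.
rewrite cons_uniq uq andbT; apply: contra uNp; rewrite !inE.
by case/orP=> [->//|/sub_q->]; rewrite orbT.
Qed.

Lemma acyclic_no_triangle x y z : acyclic_graph e -> e x y -> e y z -> ~~ e z x.
Proof.
move=> acy xy yz; apply/negP=> zx; apply: (acy [:: x; y; z]) => //.
have neq a b : e a b -> a != b by apply: contraTneq => ->; rewrite eI.
by rewrite /ucycle /= xy yz zx !inE negb_or neq // (neq y z) // eq_sym neq.
Qed.

(* Otherwise the star centred at [b] would be the whole graph. *)
Lemma nonleaf_neighbor b :
    connected_graph e -> 3 <= diameter e ->
  exists2 c, e b c & c \notin leaves e.
Proof.
move=> [_ conn] diam.
have [c /andP[bc cL]|star] := pickP (fun c => e b c && (c \notin leaves e)).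
  by exists c.
have closedS p x : path e x p -> (x == b) || e b x ->
    (last x p == b) || e b (last x p).
  elim: p x => //= y p IHp x /andP[xy ep] xS; apply: IHp => //.
  case/orP: xS => [/eqP<-|bx]; first by rewrite xy orbT.
  have := star x; rewrite bx /= => /negbFE lf.
  by rewrite (leaf_neighbor_unique lf xy (y := b)) ?eqxx // eC.
have inS x : (x == b) || e b x.
  have [p /and3P[ep _ /eqP <-]] := conn b x.
  by apply: closedS; rewrite ?eqxx.
case/negP: (isT : ~~ (3 <= 2)); apply: leq_trans diam _.
apply/bigmax_leqP=> u _; apply/bigmax_leqP=> v _.
suff [p ep [lp sz]]: exists2 p, path e u p & last u p = v /\ size p <= 2.
  have [q qP [le_q _]] := walk_is_path ep; rewrite lp in qP.
  exact: leq_trans (dist_leq qP) (leq_trans le_q sz).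
case/orP: (inS u) => [/eqP->|bu]; case/orP: (inS v) => [/eqP->|bv].
- by exists [::].
- by exists [:: v]; rewrite /= ?bv.
- by exists [:: b]; rewrite /= 1?eC ?bu.
- by exists [:: b; v]; rewrite /= ?bv 1?eC ?bu.
Qed.

End Graph.

(** * The shadow graph and its projection to the base graph *)

Definition base (V : Type) (x : V + V) : V :=
  match x with inl v => v | inr v => v end.

Section Shadow.
Variables (V : finType) (e : rel V).
Hypotheses (eC : symmetric e) (eI : irreflexive e).

Lemma shadow_inlr x v : shadow e x (inl v) = e (base x) v.
Proof. by case: x. Qed.

Lemma shadow_inll v x : shadow e (inl v) x = e v (base x).
Proof. by case: x. Qed.

Lemma shadow_base x y : shadow e x y -> e (base x) (base y).
Proof. by case: x y => [u|u] [v|v]. Qed.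

Lemma path_base x p : path (shadow e) x p -> path e (base x) (map (@base V) p).
Proof. by apply: homo_path => ? ?; apply: shadow_base. Qed.

(** Projection preserves the length of walks, so the lift is shortest. The interior vertex [z]
    matters: shadows of adjacent vertices are not adjacent. *)
Lemma geodesic_lift x y z q :
    geodesic e (base x) (base y) (z :: rcons q (base y)) ->
  geodesic (shadow e) x y (inl z :: rcons (map inl q) y).
Proof.
move=> [/and3P[/= /andP[xz ep] up lp] min_p]; split; last first.
  move=> r /path_base er lr; rewrite /= size_rcons size_map.
  by have := min_p _ er; rewrite last_map lr /= size_rcons size_map; apply.
apply/and3P; split; last by rewrite /= last_rcons.
- rewrite /= shadow_inlr xz rcons_path /= last_map shadow_inll.
  move: ep; rewrite rcons_path => /andP[eq ->]; rewrite andbT.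
  by rewrite path_map.
- apply: (@map_uniq _ _ (@base V)); rewrite /= map_rcons -map_comp.
  by rewrite (eq_map (g := id)) // map_id.
Qed.

(** * Counting copies, and the upper bound *)

Definition copied (X : {set V + V}) : {set V} :=
  [set v | (inl v \in X) || (inr v \in X)].

Lemma card_shadow_set (X : {set V + V}) :
  #|X| = #|copied X| + #|[set v | (inl v \in X) && (inr v \in X)]|.
Proof.
have injl : injective (@inl V V) by move=> ? ? [].
have injr : injective (@inr V V) by move=> ? ? [].
pose A : {set V} := [set v | inl v \in X].
pose B : {set V} := [set v | inr v \in X].
have defX : X = inl @: A :|: inr @: B.
  apply/setP=> [[v|v]]; rewrite in_setU mem_imset // inE.
    by case: imsetP => [[]//|]; rewrite orbF.
  by case: imsetP => [[]//|].
have disj : [disjoint inl @: A & inr @: B].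
  rewrite -setI_eq0; apply/eqP/setP=> x; rewrite !inE; apply/andP.
  by case=> /imsetP[v _ ->] /imsetP[].
have -> : copied X = A :|: B by apply/setP=> v; rewrite !inE.
have -> : [set v | (inl v \in X) && (inr v \in X)] = A :&: B.
  by apply/setP=> v; rewrite !inE.
rewrite cardsUI {1}defX cardsU !card_imset //.
by move: disj; rewrite -setI_eq0 => /eqP->; rewrite cards0 subn0.
Qed.

(* No shortest path is needed: every walk from [x] to [y] meets a copy of [v]. *)
Lemma not_visible_across (X : {set V + V}) v z1 z2 x y :
    acyclic_graph e -> inl v \in X -> inr v \in X ->
    e v z1 -> e v z2 -> z1 != z2 ->
    base x != v -> base y != v ->
    (base x == z1) || e z1 (base x) -> (base y == z2) || e z2 (base y) ->
  ~~ visible (shadow e) X x y.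
Proof.
move=> acy vX v'X vz1 vz2 z12 xv yv xz yz.
apply/negP=> /existsP[p /andP[/and3P[ep _ /eqP lp] /subsetP sub]].
(* A copy of [v] on the path lies in [X] and is neither [x] nor [y]. *)
suff: v \in map (@base V) (x :: p).
  case/mapP=> w wp vw; have wX : w \in X by case: w vw {wp} => w /= <-.
  have := sub w; rewrite in_setI in_set wp wX in_set2 => /(_ isT).
  by case/orP=> /eqP E; [move: xv | move: yv]; rewrite -E -vw eqxx.
(* The projected path is extended at both ends to a walk from [z1] to [z2], without adding [v]. *)
have joinP z w : (w == z) || e z w ->
    exists2 s, path e z s & last z s = w /\ {subset s <= [:: w]}.
  by case/orP=> [/eqP->|zw]; [exists [::] | exists [:: w]; rewrite /= ?zw];
    split.
have [s1 es1 [ls1 sub1]] := joinP _ _ xz.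
have zy : (z2 == base y) || e (base y) z2 by rewrite eq_sym eC.
have [s2 es2 [ls2 sub2]] := joinP _ _ zy.
have lm : last (base x) (map (@base V) p) = base y by rewrite last_map lp.
have := @acyclic_separates _ e eC v z1 z2 (s1 ++ map (@base V) p ++ s2)
  acy vz1 vz2 z12.
rewrite !cat_path !last_cat ls1 lm es1 es2 ls2 path_base // => /(_ isT erefl).
rewrite !inE !mem_cat => /or4P[/eqP E|/sub1|->|/sub2].
- by rewrite -E eI in vz1.
- by rewrite inE => /eqP->; rewrite eqxx.
- by rewrite orbT.
- by rewrite inE => /eqP E; rewrite -E eI in vz2.
Qed.

(** Since [v] has two neighbours, if both had a copied vertex other than [v] in their closed
    neighbourhoods, these would give two vertices of [X] that are not visible. *)
Lemma empty_branch (X : {set V + V}) v :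
    acyclic_graph e -> mutual_visibility (shadow e) X ->
    inl v \in X -> inr v \in X -> 1 < degree e v ->
  exists2 z, e v z &
    forall w, w != v -> (w == z) || e z w -> w \notin copied X.
Proof.
move=> acy /forall_inP mvX vX v'X /card_gt1P[z1 [z2 []]].
rewrite !inE => vz1 vz2 z12.
pose meets z := [exists w, [&& w != v, (w == z) || e z w & w \in copied X]].
have emptyP z : ~~ meets z ->
    forall w, w != v -> (w == z) || e z w -> w \notin copied X.
  by move/existsPn=> noz w wv wz; have := noz w; rewrite wv wz.
have [m1|/emptyP] := boolP (meets z1); last by exists z1.
have [m2|/emptyP] := boolP (meets z2); last by exists z2.
have copyP z : meets z -> exists2 x, x \in X &
    base x != v /\ ((base x == z) || e z (base x)).
  case/existsP=> w /and3P[wv wz]; rewrite inE.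
  by case/orP=> wX; [exists (inl w) | exists (inr w)].
have [x xX [xv xz]] := copyP _ m1; have [y yX [yv yz]] := copyP _ m2.
case/negP: (not_visible_across acy vX v'X vz1 vz2 z12 xv yv xz yz).
exact: (forall_inP (mvX x xX)).
Qed.

Lemma mutual_visibility_shadow_leq (X : {set V + V}) :
    acyclic_graph e -> (forall v, 0 < degree e v) ->
    mutual_visibility (shadow e) X ->
  #|X| <= #|V| + #|leaves e|.
Proof.
move=> acy deg_gt0 mvX; rewrite card_shadow_set -(cardsC (copied X)) -addnA.
rewrite leq_add2l; set D := [set v | _].
have DP v : v \in D -> inl v \in X /\ inr v \in X by rewrite inE => /andP.
(* Leaves counted twice are absorbed by [#|leaves e|]; the other elements of [D] are to be injected
   into the complement of [copied X]. *)
rewrite -(cardsID (leaves e) D) addnC leq_add //; last first.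
  exact/subset_leq_card/subsetIr.
pose branch v z := e v z &&
  [forall (w | w != v), ((w == z) || e z w) ==> (w \notin copied X)].
(* The default [v] is taken only outside [D :\: leaves e]. *)
pose f v := odflt v [pick z | branch v z].
have fP v : v \in D :\: leaves e -> branch v (f v).
  rewrite inE inE => /andP[vL /DP[vX v'X]]; rewrite /f.
  case: pickP => //= noz.
  have deg_v : 1 < degree e v by rewrite ltn_neqAle eq_sym vL deg_gt0.
  have [z vz zP] := empty_branch acy mvX vX v'X deg_v.
  case/negP: (noz z); rewrite /branch vz; apply/forall_inP=> w wv.
  by apply/implyP; apply: zP.
(* If [f u = f v] with [u != v], then [u] is a neighbour of [f v] other than [v], hence has no copy
   in [X], against [u \in D]. *)
have f_inj : {in D :\: leaves e &, injective f}.
  move=> u v uD vD fuv; apply: contraTeq isT => uv.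
  have /andP[vz /forall_inP/(_ u uv)] := fP v vD.
  have /andP[] := fP u uD; rewrite -fuv eC => -> _; rewrite orbT /=.
  by case/setDP: uD => /DP[uX _] _; rewrite inE uX.
rewrite -(card_in_imset f_inj);
apply/subset_leq_card/subsetP=> _ /imsetP[v vD ->].
have /andP[vz /forall_inP fvP] := fP v vD; rewrite in_setC.
by apply: (implyP (fvP _ _)); rewrite ?eqxx //;
  apply: contraTneq vz => ->; rewrite eI.
Qed.

(** * The extremal set, and the lower bound *)

Definition shadows_and_leaves : {set V + V} :=
  [set x | if x is inl v then v \in leaves e else true].

Lemma card_shadows_and_leaves : #|shadows_and_leaves| = #|V| + #|leaves e|.
Proof.
rewrite card_shadow_set; congr (_ + _).
  by rewrite -cardsT; apply: eq_card => v; rewrite !inE orbT.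
by apply: eq_card => v; rewrite !inE andbT.
Qed.

Lemma mutual_visibility_shadows_and_leaves :
    connected_graph e -> acyclic_graph e -> 3 <= diameter e ->
  mutual_visibility (shadow e) shadows_and_leaves.
Proof.
move=> conn acy diam; set X := shadows_and_leaves.
have nbr b := @nonleaf_neighbor _ e eC b conn diam.
have leaf_nbr u v : u \in leaves e -> e u v -> v \notin leaves e.
  by move=> uL uv; have [w uw] := nbr u;
    rewrite (leaf_neighbor_unique uL uv uw).
have notX v : (inl v \in X) = (v \in leaves e) by rewrite inE.
have visible_via x y p : geodesic (shadow e) x (y : V + V) (rcons p y) ->
    {in p, forall w, w \notin X} -> visible (shadow e) X x y.
  move=> gp avoid; apply: geodesic_visible gp _ => w.
  by rewrite mem_rcons inE => /orP[/eqP->//|/avoid/negP].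
apply/forall_inP=> x xX; apply/forall_inP=> y yX.
have [<-{y yX}|xy] := eqVneq x y.
  by apply: (@geodesic_visible _ _ _ _ _ [::]) => //; split;
    rewrite // /is_path /= eqxx.
(* The two copies of one vertex are at distance 2, through a non-leaf neighbour. *)
have [bxy|bxy] := eqVneq (base x) (base y).
  have [w uw wL] := nbr (base x).
  apply: (visible_via _ _ [:: inl w]); last first.
    by move=> z; rewrite inE => /eqP->; rewrite notX.
  split; last first.
    case=> [_ /= E|z [|//]]; first by rewrite E eqxx in xy.
    by rewrite /= andbT => /shadow_base + zy; rewrite zy bxy eI.
  have xw : shadow e x (inl w) by rewrite shadow_inlr.
  have wy : shadow e (inl w) y by rewrite shadow_inll -bxy eC.
  apply/and3P; split=> //; first by apply/and3P.
  rewrite cons_uniq !inE negb_or xy /= andbT inE andbT.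
  by apply/andP; split; apply: contraTneq uw => E;
    [rewrite E | rewrite bxy -E]; rewrite eI.
have [p gp] := geodesic_exists (conn.2 (base x) (base y)).
case: p gp => [|z p] gp.
  by case: gp => /and3P[_ _ /= /eqP E]; rewrite E eqxx in bxy.
case: (lastP p) gp => [|{}p t] gp.
  have exy : e (base x) (base y).
    by case: gp => /and3P[/= /andP[xz _] _ /eqP <-].
  have [sxy|] := boolP (shadow e x y).
    apply: (visible_via _ _ [::]) => //; split.
      by rewrite /is_path /= sxy eqxx inE xy.
    by case=> //= _ E; rewrite E eqxx in xy.
  case: x y exy {xX yX xy bxy gp} => [a|a] [b|b] /= ab; rewrite ?ab // => _.
  (* A walk of length 2 would project to a triangle through the edge [ab]. *)
  have far q :
      path (shadow e) (inr a) q -> last (inr a) q = inr b -> 3 <= size q.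
    case: q => [_ [E]|[w|w] [|y [|//]]] //=; first by rewrite E eI in ab.
    move=> /and3P[aw wy _] yb; rewrite yb in wy.
    by have := acyclic_no_triangle eI acy aw wy; rewrite eC ab.
  (* [inl b] may be an interior vertex only if [b] is no leaf. If [b] is a leaf, the detour is made
     at [a], which then is no leaf; otherwise it is made at [b]. *)
  have [bL|bL] := boolP (b \in leaves e).
    have [c ac cL] := nbr a.
    have aL : a \notin leaves e by apply: leaf_nbr bL _; rewrite eC.
    apply: (visible_via _ _ [:: inl c; inl a]); last first.
      by move=> w; rewrite !inE => /orP[] /eqP->.
    split; last by move=> q; apply: far.
    rewrite /is_path /= ac (eC c) ac ab !inE eqxx /= !andbT orbF.
    by apply/andP; split; [move: ab | move: ac];
      apply: contraTneq => [[->]]; rewrite eI.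
  have [c bc cL] := nbr b.
  apply: (visible_via _ _ [:: inl b; inl c]); last first.
    by move=> w; rewrite !inE => /orP[] /eqP->.
  split; last by move=> q; apply: far.
  rewrite /is_path /= ab bc (eC c) bc !inE eqxx /= !andbT orbF.
  by apply/andP; split; [move: ab | move: bc];
      apply: contraTneq => [[->]]; rewrite eI.
(* The base vertices are now at distance at least 2, so their geodesic lifts, with its interior on
   original non-leaves. *)
have /and3P[ep up] := gp.1; rewrite /= last_rcons => /eqP tE.
rewrite tE in gp ep up.
apply: (visible_via _ _ (inl z :: map inl p)); first exact: geodesic_lift.
move=> w; rewrite -map_cons => /mapP[v vp ->]; rewrite notX.
by apply: (interior_nonleaf eC) vp; [exact: ep | exact: up].
Qed.

End Shadow.

Theorem theorem4p5 (V : finType) (e : rel V) :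
  is_tree e -> 3 <= diameter e ->
  mu (shadow e) = #|V| + #|leaves e|.
Proof.
case=> [[eC eI] conn acy] diam; apply/eqP; rewrite eqn_leq; apply/andP; split.
  apply/bigmax_leqP=> X; apply: mutual_visibility_shadow_leq => // v.
  have [w vw _] := nonleaf_neighbor eC v conn diam.
  by apply/card_gt0P; exists w; rewrite inE.
rewrite -(card_shadows_and_leaves e).
rewrite /mu (bigD1 (shadows_and_leaves e)) /= ?leq_maxl //.
exact: mutual_visibility_shadows_and_leaves.
Qed.
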